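(* Let $a_1,\ldots,a_m$ be positive integers, and let $p$, $M_m$, the compact graph and the Sturmian graph be as defined in the context. Consider, in the tree of central words (resp. in the Stern-Brocot tree), the path from the root to $p$ (resp. to the slope $s=|M_m|_b/|M_m|_a$ of $M_m$). Direct the edges downwards, and label each edge $u\to v$ by the word $u^{-1}v$ (resp. each edge $r/t\to r'/t'$ by the integer $r'+t'-r-t$). Add an edge from each vertex to the first vertex after the first turn below on the path; the label of a new edge depends only on its final vertex (it is the label of the edge of the path ending at that vertex). This graph is the compact graph (resp. the Sturmian graph).
   Context: Words are over $A=\{a,b\}$; $|w|_x$ is the number of occurrences of the letter $x$ in $w$. Given positive integers $a_1,\ldots,a_m$: $b_1=a_1-1$, $b_i=a_i$ for $i\ge2$; $M_{-1}=b$, $M_0=a$, $M_i=M_{i-1}^{\,b_i}M_{i-2}$ for $1\le i\le m$; $L_i=\widetilde{M_i}$ is the reversal of $M_i$. Put $c_i=a_i$ for $i=2,\ldots,m-1$ and $c_i=a_i-1$ for $i=1,m$. The word $M_m$ equals $pab$ ($m$ odd) or $pba$ ($m$ even) for a palindrome $p$, called the central word of the conjugation class of $M_m$. It has the factorization $p=L_0^{c_1}L_1^{c_2}\cdots L_{m-1}^{c_m}$. Compact graph: a directed edge-labelled graph. View $L_0^{c_1}L_1^{c_2}\cdots L_{m-1}^{c_m}$ as a formal word over the letters $L_0,\ldots,L_{m-1}$; the vertices are its $c_1+\cdots+c_m+1$ formal prefixes. For each vertex of the form $UL_i$ ($0\le i\le m-1$) there is an edge labelled $L_i$ from $U$ to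 $UL_i$. Moreover, if $i<m-1$ and $k\ge1$, for each vertex of the form $UL_i^kL_{i+1}$ there is an edge labelled $L_{i+1}$ from $U$ to $UL_i^kL_{i+1}$. The Sturmian graph is obtained from the compact graph by replacing each label by its length. Iterated palindromization: for a word $w$, $w^{(+)}$ is the shortest palindrome having $w$ as a prefix; $Pal(1)=1$ for the empty word $1$, and $Pal(wx)=(Pal(w)x)^{(+)}$ for a word $w$ and a letter $x$. $Pal$ is a bijection from $\{a,b\}^*$ onto the set of central words. Tree of central words: the complete infinite binary tree whose node reached from the root by the path coded by $v\in\{a,b\}^*$ ($a$ = left, $b$ = right) is the word $Pal(v)$. Stern-Brocot tree: the usual complete infinite binary tree of positive rationals (written as reduced fractions) with root $1/1$, coded in the same way. Turns: if the path is coded by $v$ and a vertex on it is coded by the prefix $u$, with $v=ux_1x_2\cdots x_n$ ($x_i$ letters), then the first vertex after the first turn below is the vertex coded by $ux_1\cdots x_j$, where $j\ge2$ is the smallest index with $x_j\ne x_1$ (there is no new edge if there is no such $j$).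
   Formalization: For m=1 the exponent is taken as c_1=a_1-2 instead of a_1-1, since M_1=a^{a_1-1}b=pab forces p=a^{a_1-2}; the case m=a_1=1, where M_1=b and p does not exist, is excluded. *)

(* Defs.v *)
From mathcomp Require Import all_boot all_order all_algebra.
Set Implicit Arguments.
Unset Strict Implicit.
Unset Printing Implicit Defensive.
Import GRing.Theory.

(* Words over {a,b}: the letter a is [false] and the letter b is [true];
   in codes of paths in a binary tree, a is "left" and b is "right". *)
Notation letter := bool.
Notation word := (seq bool).
Notation la := false.
Notation lb := true.

(* The partial quotients a_1, ..., a_m are the values a 1, ..., a m of a
   function a : nat -> nat; its other values are never used. *)

Definition bexp (a : nat -> nat) (i : nat) : nat :=
  if i == 1 then a i - 1 else a i.

(* Indices are shifted by one: Mshift a n is M_{n-1}, because the sequence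
   starts at M_{-1} = b. *)
Fixpoint Mshift (a : nat -> nat) (n : nat) : word :=
  match n with
  | 0 => [:: lb]
  | n1.+1 =>
      match n1 with
      | 0 => [:: la]
      | n2.+1 => flatten (nseq (bexp a n1) (Mshift a n1)) ++ Mshift a n2
      end
  end.

Definition Mword (a : nat -> nat) (i : nat) : word := Mshift a i.+1.

Definition Lword (a : nat -> nat) (i : nat) : word := rev (Mword a i).

(* For m = 1 the indices i = 1 and i = m coincide and 1 is subtracted twice:
   M_1 = a^{a_1 - 1} b = pab gives p = a^{a_1 - 2}, so this is what
   p = L_0^{c_1} requires. *)
Definition cexp (m : nat) (a : nat -> nat) (i : nat) : nat :=
  a i - (i == 1) - (i == m).

Definition shortest_palindrome (w q : word) : Prop :=
  [/\ rev q = q, prefix w q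
    & forall q' : word, rev q' = q' -> prefix w q' -> size q <= size q'].

Lemma palindrome_prefix_size (w q : word) :
  rev q = q -> prefix w q -> size q <= (size w).*2 ->
  q = w ++ rev (take (size q - size w) w).
Proof.
move=> palq /prefixP[s qE] leq.
have szq : size q = size w + size s by rewrite qE size_cat.
have les : size s <= size w.
  by move: leq; rewrite szq -addnn leq_add2l.
have -> : size q - size w = size s by rewrite szq addKn.
rewrite {1}qE; congr (_ ++ _).
have : take (size s) (rev q) = take (size s) q by rewrite palq.
rewrite {1}qE rev_cat take_size_cat ?size_rev // qE takel_cat //.
by move=> <-; rewrite revK.
Qed.

Lemma shortest_palindrome_exists (w : word) :
  {q : word | shortest_palindrome w q}.
Proof.
pose P n := let q := w ++ rev (take n w) in rev q == q.
have exP : exists n, P n.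
  by exists (size w); rewrite /P take_size rev_cat revK.
case: (ex_minnP exP) => n /eqP palq minn.
exists (w ++ rev (take n w)); split=> //; first exact: prefix_prefix.
move=> q' palq' prq'.
have [big|small] := leqP (size (w ++ rev (take n w))) (size q') => //.
have le2 : size q' <= (size w).*2.
  apply: leq_trans (ltnW small) _.
  by rewrite size_cat size_rev -addnn leq_add2l size_take_min geq_minr.
have q'E := palindrome_prefix_size palq' prq' le2.
have /minn len : P (size q' - size w) by rewrite /P /= -q'E palq'.
move: small; rewrite size_cat size_rev size_take_min.
rewrite ltnNge => /negP[]; apply: leq_trans (leq_add (leqnn _) (geq_minl _ _)) _.
by apply: leq_trans (leq_add (leqnn _) len) _; rewrite subnKC // size_prefix.
Qed.

Lemma shortest_palindrome_uniq (w q1 q2 : word) :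
  shortest_palindrome w q1 -> shortest_palindrome w q2 -> q1 = q2.
Proof.
move=> [p1 w1 min1] [p2 w2 min2].
have sz : size q1 = size q2.
  by apply/eqP; rewrite eqn_leq min1 // min2.
have le : size q1 <= (size w).*2.
  rewrite -addnn -[X in _ + X](size_rev w) -size_cat; apply: min1.
    by rewrite rev_cat revK.
  exact: prefix_prefix.
rewrite (palindrome_prefix_size p1 w1 le).
by rewrite [RHS](palindrome_prefix_size p2 w2) -sz.
Qed.

Definition pal_closure (w : word) : word :=
  sval (shortest_palindrome_exists w).

Definition Pal (v : word) : word :=
  foldl (fun p x => pal_closure (rcons p x)) [::] v.

(* Fractions are pairs (numerator, denominator). A subtree of the
   Stern-Brocot tree is given by the two fractions (starting with 0/1 and 1/0)
   whose mediant is its root. *)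
Definition mediant (x y : nat * nat) : nat * nat := (x.1 + y.1, x.2 + y.2).

Definition stern_brocot_step (I : (nat * nat) * (nat * nat)) (x : letter) :
    (nat * nat) * (nat * nat) :=
  if x then (mediant I.1 I.2, I.2) else (I.1, mediant I.1 I.2).

Definition SternBrocot (v : word) : rat :=
  let I := foldl stern_brocot_step ((0, 1), (1, 0)) v in
  let n := mediant I.1 I.2 in
  (n.1%:R / n.2%:R)%R.

Record lgraph (V L : Type) := LGraph {
  vertex : V -> Prop;
  edge : V -> L -> V -> Prop
}.

Definition isomorphic (V V' L : Type) (G : lgraph V L) (G' : lgraph V' L) :
    Prop :=
  exists f : V -> V',
    [/\ forall x, vertex G x -> vertex G' (f x),
        forall x y, vertex G x -> vertex G y -> f x = f y -> x = y,
        forall y, vertex G' y -> exists2 x, vertex G x & f x = y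
      & forall x l y, vertex G x -> vertex G y ->
          (edge G x l y <-> edge G' (f x) l (f y))].

Definition map_labels (V L L' : Type) (f : L -> L') (G : lgraph V L) :
    lgraph V L' :=
  LGraph (vertex G) (fun x l' y => exists2 l, edge G x l y & l' = f l).

(* Formal words over L_0, ..., L_{m-1} are sequences of indices; in edge labels
   the formal letter L_i is read as the word it denotes. *)
Definition formal_word (m : nat) (a : nat -> nat) : seq nat :=
  flatten [seq nseq (cexp m a i.+1) i | i <- iota 0 m].

Definition compact_edge (m : nat) (a : nat -> nat)
    (U : seq nat) (l : word) (V : seq nat) : Prop :=
  prefix V (formal_word m a) /\
  ((exists i, [/\ i < m, V = U ++ [:: i] & l = Lword a i]) \/
   (exists i k, [/\ i < m.-1, 1 <= k, V = U ++ nseq k i ++ [:: i.+1]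
                  & l = Lword a i.+1])).

Definition compact_graph (m : nat) (a : nat -> nat) : lgraph (seq nat) word :=
  LGraph (fun U => prefix U (formal_word m a)) (compact_edge m a).

Definition sturmian_graph (m : nat) (a : nat -> nat) : lgraph (seq nat) int :=
  map_labels (fun w : word => Posz (size w)) (compact_graph m a).

(* In the path coded by v, w codes the first vertex after the first turn below
   the vertex coded by u; the letter x_i is [nth la x i.-1]. *)
Definition after_first_turn (v u w : word) : Prop :=
  exists (x : word) (j : nat),
    [/\ v = u ++ x,
        2 <= j <= size x,
        nth la x j.-1 != nth la x 0,
        forall i, 2 <= i < j -> nth la x i.-1 = nth la x 0
      & w = u ++ take j x].

(* [node] gives the vertex of an infinite binary tree reached by a coded path,
   and [lab s l t] says that l is the label of the tree edge s -> t. *)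
Definition path_edge (T L : Type) (node : word -> T) (lab : T -> L -> T -> Prop)
    (v : word) (s : T) (l : L) (t : T) : Prop :=
  exists u x, [/\ prefix (rcons u x) v, s = node u, t = node (rcons u x)
                & lab s l t].

Definition turn_edge (T L : Type) (node : word -> T) (lab : T -> L -> T -> Prop)
    (v : word) (s : T) (l : L) (t : T) : Prop :=
  (exists u w, [/\ after_first_turn v u w, s = node u & t = node w]) /\
  (exists r, path_edge node lab v r l t).

Definition path_graph (T L : Type) (node : word -> T)
    (lab : T -> L -> T -> Prop) (v : word) : lgraph T L :=
  LGraph (fun s => exists2 u, prefix u v & s = node u)
         (fun s l t => path_edge node lab v s l t \/ turn_edge node lab v s l t).

Definition central_label (u l v : word) : Prop := v = u ++ l.

(* numq and denq are the numerator and denominator in lowest terms. *)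
Definition stern_brocot_label (q : rat) (l : int) (q' : rat) : Prop :=
  l = (numq q' + denq q' - numq q - denq q)%R.

Definition central_path_graph (v : word) : lgraph word word :=
  path_graph Pal central_label v.

Definition stern_brocot_path_graph (v : word) : lgraph rat int :=
  path_graph SternBrocot stern_brocot_label v.

Definition slope (w : word) : rat :=
  ((count_mem lb w)%:R / (count_mem la w)%:R)%R.

(* Main.v *)
Require Import Defs.
From mathcomp Require Import all_boot all_order all_algebra.
From mathcomp Require Import zify.

Set Implicit Arguments.
Unset Strict Implicit.
Unset Printing Implicit Defensive.

Import GRing.Theory Num.Theory.

(** Write the formal word as a sequence [F] of block indices. The path that
    leads to the central word is coded by the parities of [F]: the block of
    [L_i] becomes a run of [c_(i+1)] equal letters, [a] for even [i] and [b] for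
    odd [i]. So the vertices of both graphs are the positions [0, ..., |F|], and
    three facts about positions remain.

    Labels. The edge from [Pal u] to [Pal (ux)] is labelled by a word
    [next_label u x] that obeys a simple recursion: after a step [y], the label
    in direction [y] is unchanged and the other one is followed by it
    ([Pal_rcons_label]). This is Justin's formula for palindromic closure in
    disguise; it rests on knowing the longest palindromic prefix of [Pal u]
    that is followed by [x] ([Pal_completes]). Over a run of [c_(n+1) = b_(n+1)]
    equal letters one label stays [L_n] and the other grows from [L_(n-1)] to
    [L_(n-1) L_n^(b_(n+1)) = L_(n+1)] ([next_label_blocks]), so the labels along
    the path spell the formal word. At the end of the path, where
    [c_m = b_m - 1], the two labels multiply to [L_m], and since their product
    is always [Pal u] preceded by two letters ([next_label_cat]), the path ends
    at [p] ([Mword_Pal]).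

    Turns. Only the first and the last block can be empty, so consecutive
    entries of [F] are equal or differ by one. Hence a change of parity is
    exactly a change of block, and the jumps to the first vertex after the first
    turn are the edges from [U] to [U L_i^k L_(i+1)] ([first_turn_block]).

    Stern-Brocot. The interval bounds count the letters of the two next labels,
    so the fraction coded by [v] is [(|Pal v|_b + 1) / (|Pal v|_a + 1)]
    ([stern_brocot_pair_Pal]). It is in lowest terms, whence numerator plus
    denominator is [|Pal v| + 2], and the integer labels are the lengths of the
    word labels. Since distinct paths give distinct fractions, they also give
    distinct central words ([Pal_inj]). *)

(** * Labels of the tree of central words *)

(** The word [next_label u x] turns out to be the label of the edge from the
    vertex coded by [u] to its child in direction [x]. The recursion is that of
    the bounds of the Stern-Brocot intervals, with concatenation in place of the
    mediant. *)
Definition next_label (u : word) : letter -> word :=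
  foldl (fun lab x y => if y == x then lab y else lab y ++ lab x)
        (fun y => [:: y]) u.

Lemma next_label_rcons u x y :
  next_label (rcons u x) y =
  if y == x then next_label u y else next_label u y ++ next_label u x.
Proof. by rewrite /next_label foldl_rcons. Qed.

Lemma negb_eqF (x : bool) : (~~ x == x) = false.
Proof. by case: x. Qed.

Lemma next_label_nseq u x n :
  next_label (u ++ nseq n x) x = next_label u x /\
  next_label (u ++ nseq n x) (~~ x) =
    next_label u (~~ x) ++ flatten (nseq n (next_label u x)).
Proof.
elim: n => [|n [IHx IHy]]; first by rewrite !cats0.
rewrite -[n.+1]addn1 nseqD catA cats1 !next_label_rcons eqxx IHx IHy.
by rewrite negb_eqF nseqD flatten_cat /= cats0 catA.
Qed.

Lemma next_label_head u x : exists l, next_label u x = x :: l.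
Proof.
elim/last_ind: u => [|u y [l IH]]; first by exists [::].
by rewrite next_label_rcons IH; case: eqP => _; eexists.
Qed.

Lemma prefix_leq (T : eqType) (s1 s2 s : seq T) :
  prefix s1 s -> prefix s2 s -> size s1 <= size s2 -> prefix s1 s2.
Proof.
rewrite !prefixE => /eqP eq1 /eqP eq2 le12.
by rewrite -[X in take _ X]eq2 take_takel ?eq1.
Qed.

(** If [q] is a short palindrome starting with [px], then the overlap of the
    prefix [p] of [q] with its suffix [p] is a palindrome [t], and in the
    prefix [p] of [q] an occurrence of [t] is followed by [x]. *)
Lemma short_palindrome_overlap (p q : word) x :
  rev p = p -> rev q = q -> prefix (rcons p x) q -> size q <= (size p).*2 ->
  exists t, [/\ rev t = t, prefix (rcons t x) p
              & size q + size t = (size p).*2].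
Proof.
move=> palp palq prq szq.
have [s qE] : exists s : word, q = rcons p x ++ s by exact/prefixP.
have qE' : q = rev s ++ x :: p by rewrite -palq qE rev_cat rev_rcons palp.
have lts : size s < size p by move: szq; rewrite qE size_cat size_rcons -addnn; lia.
pose t := drop (size s).+1 p.
have pE : p = rcons (rev s) x ++ t.
  have : take (size s).+1 q = take (size s).+1 p.
    by rewrite qE -cats1 -catA takel_cat.
  rewrite qE' -cat_rcons take_size_cat ?size_rcons ?size_rev // => ->.
  by rewrite cat_take_drop.
have pE' : p = t ++ x :: s.
  have : rcons p x ++ s = rev s ++ x :: p by rewrite -qE.
  rewrite {1}pE -!cats1 -!catA /= => /eqP; rewrite eqseq_cat // eqxx /=.
  by rewrite eqseq_cons eqxx => /eqP.
have palt : rev t = t.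
  have : rev p = p by [].
  rewrite {1}pE' pE rev_cat rev_cons => /eqP.
  by rewrite eqseq_cat // eqxx => /eqP.
exists t; split=> //; first by rewrite [X in prefix _ X]pE' -cat_rcons prefix_prefix.
by rewrite qE size_cat size_rcons size_drop -addnn; lia.
Qed.

(** Here [p = tl], where [t] is the longest palindromic prefix of [p] that [x]
    follows; if there is no such prefix, [l = xp], which amounts to a [t] of
    length -1. Appending [l] to [p] is then the cheapest way to complete
    [px] to a palindrome. *)
Definition completes (p : word) (x : letter) (l : word) : Prop :=
  (l = x :: p \/ exists2 t, rev t = t & p = t ++ l) /\
  (forall t, rev t = t -> prefix (rcons t x) p -> size t + size l <= size p).

Lemma completes_shortest (p l : word) x :
  rev p = p -> completes p x (x :: l) ->
  shortest_palindrome (rcons p x) (p ++ x :: l).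
Proof.
move=> palp [shape longest]; split.
- case: shape => [->|[t palt pE]]; first by rewrite rev_cat rev_cons palp cat_rcons.
  by rewrite rev_cat palp {1}pE catA -{1}palt -rev_cat -pE palp.
- by rewrite -cat_rcons prefix_prefix.
- move=> q palq prq; rewrite leqNgt; apply/negP => ltq.
  have lel : size l <= size p.
    by case: shape => [[->]|[t _ ->]] //; rewrite size_cat /=; lia.
  rewrite size_cat /= in ltq.
  have [|t [palt prt]] := short_palindrome_overlap palp palq prq.
    by rewrite -addnn; lia.
  by rewrite -addnn; move: (longest t palt prt) => /=; lia.
Qed.

Lemma pal_closureP w q : shortest_palindrome w q -> pal_closure w = q.
Proof. exact/shortest_palindrome_uniq/(svalP (shortest_palindrome_exists w)). Qed.

Lemma Pal_rcons u x : Pal (rcons u x) = pal_closure (rcons (Pal u) x).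
Proof. by rewrite /Pal foldl_rcons. Qed.

Lemma Pal_palindrome u : rev (Pal u) = Pal u.
Proof.
case/lastP: u => // u x; rewrite Pal_rcons.
by case: (svalP (shortest_palindrome_exists (rcons (Pal u) x))).
Qed.

(** A palindromic prefix of [Pal (uy)] is either [Pal (uy)] itself or no longer
    than [Pal u], because [Pal (uy)] is the shortest palindrome that starts
    with [Pal u] and [y]. So [Pal u] is the longest one followed by [y], and
    those followed by the other letter all lie inside [Pal u]. *)
Lemma Pal_completes u x : completes (Pal u) x (next_label u x).
Proof.
elim/last_ind: u x => [|u y IH] x.
  by split; [left | move=> t _; rewrite prefixs0; case: t].
have [l lE] := next_label_head u y.
have short : shortest_palindrome (rcons (Pal u) y) (Pal u ++ y :: l).
  by apply: completes_shortest; rewrite ?Pal_palindrome -?lE.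
have PE : Pal (rcons u y) = Pal u ++ next_label u y.
  by rewrite Pal_rcons lE; apply: pal_closureP.
have prW : prefix (rcons (Pal u) y) (Pal u ++ next_label u y).
  by rewrite lE -cat_rcons prefix_prefix.
have bound t z : rev t = t -> prefix (rcons t z) (Pal u ++ next_label u y) ->
    size t <= size (Pal u).
  move=> palt prt; rewrite leqNgt; apply/negP => lt_t.
  have [_ _ /(_ t palt)] := short; rewrite -lE => minimal.
  have /minimal : prefix (rcons (Pal u) y) t.
    by apply: prefix_leq prW (prefix_trans (prefix_rcons t z) prt) _;
      rewrite size_rcons.
  by rewrite leqNgt -(size_rcons t z) size_prefix.
rewrite PE next_label_rcons; case: (x =P y) => [->|neq].
  split; first by right; exists (Pal u) => //; exact: Pal_palindrome.
  by move=> t palt /(bound _ _ palt); rewrite size_cat leq_add2r.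
have [shape longest] := IH x; split.
  case: shape => [->|[t palt pE]]; first by left.
  by right; exists t; rewrite // catA -pE.
move=> t palt prt; have le_t := bound t x palt prt.
have [lt_t|ge_t] := ltnP (size t) (size (Pal u)).
  have /(longest t palt) : prefix (rcons t x) (Pal u).
    by apply: prefix_leq prt (prefix_prefix _ _) _; rewrite size_rcons.
  by rewrite !size_cat addnA leq_add2r.
have : prefix (rcons t x) (rcons (Pal u) y).
  by apply: prefix_leq prt prW _; rewrite !size_rcons.
move/prefixP=> [s /(congr1 (take (size (rcons t x))))].
rewrite take_size_cat // take_oversize ?size_rcons // => /rcons_inj[_ eqxy].
by case: neq.
Qed.

Lemma Pal_rcons_label u x : Pal (rcons u x) = Pal u ++ next_label u x.
Proof.
have [l lE] := next_label_head u x.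
rewrite Pal_rcons lE; apply/pal_closureP/completes_shortest.
  exact: Pal_palindrome.
by rewrite -lE; exact: Pal_completes.
Qed.

(** Both sides are extended by the same label when [u] grows by a letter. *)
Lemma next_label_cat u x :
  next_label u x ++ next_label u (~~ x) = [:: x, ~~ x & Pal u].
Proof.
elim/last_ind: u x => [|u y IH] x //; rewrite Pal_rcons_label !next_label_rcons.
have [->|->] : x = y \/ x = ~~ y by case: x y => [] [] ; [left|right|right|left].
  by rewrite eqxx negb_eqF catA IH.
by rewrite negbK eqxx negb_eqF; have := IH (~~ y); rewrite negbK => ->.
Qed.

(** * Stern-Brocot fractions *)

(** Read from the root, a step to the left maps [n/d] to [n/(n+d)] and a step to
    the right maps it to [(n+d)/d]. *)
Definition first_step (x : letter) (f : nat * nat) : nat * nat :=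
  if x then (f.1 + f.2, f.2) else (f.1, f.1 + f.2).

Definition stern_brocot_pair (v : word) : nat * nat :=
  let I := foldl stern_brocot_step ((0, 1), (1, 0)) v in mediant I.1 I.2.

Lemma first_step_mediant x f g :
  first_step x (mediant f g) = mediant (first_step x f) (first_step x g).
Proof. by case: x f g => [] [? ?] [? ?]; rewrite /mediant /= addnACA. Qed.

Lemma stern_brocot_pair_cons x v :
  stern_brocot_pair (x :: v) = first_step x (stern_brocot_pair v).
Proof.
have comm I : foldl stern_brocot_step (first_step x I.1, first_step x I.2) v =
    (first_step x (foldl stern_brocot_step I v).1,
     first_step x (foldl stern_brocot_step I v).2).
  elim: v I => [|y v IH] I //=; rewrite -IH /stern_brocot_step.
  by case: y; rewrite /= first_step_mediant.
have := comm ((0, 1), (1, 0)); rewrite first_step_mediant /stern_brocot_pair.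
by case: x {comm} => /= ->.
Qed.

Lemma stern_brocot_pair_gt0 v :
  0 < (stern_brocot_pair v).1 /\ 0 < (stern_brocot_pair v).2.
Proof.
elim: v => [|x v]; rewrite ?stern_brocot_pair_cons //.
by case: (stern_brocot_pair v) => n d /= [n0 d0]; case: x; split=> /=; lia.
Qed.

Lemma stern_brocot_pair_coprime v :
  coprime (stern_brocot_pair v).1 (stern_brocot_pair v).2.
Proof.
elim: v => [|x v] //; rewrite stern_brocot_pair_cons /coprime.
case: (stern_brocot_pair v) => n d; case: x; rewrite /= ?gcdnDl //.
by rewrite [gcdn (_ + _) _]gcdnC gcdnDr gcdnC.
Qed.

(** The first letter of [v] tells whether the fraction is below or above 1. *)
Lemma stern_brocot_pair_inj : injective stern_brocot_pair.
Proof.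
elim=> [|x u IH] [|y v] //; rewrite !stern_brocot_pair_cons.
- have := stern_brocot_pair_gt0 v; case: (stern_brocot_pair v) => n d /= [].
  by case: y => /= n0 d0 []; lia.
- have := stern_brocot_pair_gt0 u; case: (stern_brocot_pair u) => n d /= [].
  by case: x => /= n0 d0 []; lia.
have := stern_brocot_pair_gt0 u; have := stern_brocot_pair_gt0 v.
have := IH v; case: (stern_brocot_pair u) (stern_brocot_pair v) => [n d] [n' d'].
move=> inj_v /= [n'0 d'0] [n0 d0].
by case: x y => [] [] /= [e1 e2]; try (congr (_ :: _); apply: inj_v; congr pair; lia);
  exfalso; lia.
Qed.

Lemma SternBrocotE v :
  SternBrocot v =
  ((stern_brocot_pair v).1%:R / (stern_brocot_pair v).2%:R)%R.
Proof. by []. Qed.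

Lemma SternBrocot_reduced v :
  numq (SternBrocot v) = Posz (stern_brocot_pair v).1 /\
  denq (SternBrocot v) = Posz (stern_brocot_pair v).2.
Proof.
have [_ d0] := stern_brocot_pair_gt0 v; have cop := stern_brocot_pair_coprime v.
case: (stern_brocot_pair v) (SternBrocotE v) d0 cop => n d /= -> d0 cop.
by rewrite !pmulrn coprimeq_num ?coprimeq_den //= gtr0_sg ?mul1r //; case: d d0 {cop}.
Qed.

(** The interval bounds [I.1] and [I.2] count the letters of the two next
    labels, so their mediant counts those of the word [ab Pal v]. *)
Lemma stern_brocot_pair_Pal v :
  stern_brocot_pair v =
  ((count_mem lb (Pal v)).+1, (count_mem la (Pal v)).+1).
Proof.
pose counts (w : word) := (count_mem lb w, count_mem la w).
have bounds : foldl stern_brocot_step ((0, 1), (1, 0)) v =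
    (counts (next_label v la), counts (next_label v lb)).
  elim/last_ind: v => [|v x IH] //; rewrite foldl_rcons IH !next_label_rcons.
  by case: x => /=; rewrite /stern_brocot_step /mediant /counts /= !count_cat //
    ![count_mem _ (next_label v lb) + _]addnC.
have catE := next_label_cat v la.
rewrite /stern_brocot_pair bounds /mediant /= -!count_cat catE /=.
by rewrite add0n add1n.
Qed.

Lemma SternBrocot_inj : injective SternBrocot.
Proof.
move=> u v eq_uv; apply: stern_brocot_pair_inj.
have [nu du] := SternBrocot_reduced u; have [nv dv] := SternBrocot_reduced v.
rewrite -eq_uv nu in nv; rewrite -eq_uv du in dv.
by case: (stern_brocot_pair u) (stern_brocot_pair v) nv dv => [? ?] [? ?] [->] [->].
Qed.

Lemma Pal_inj : injective Pal.
Proof.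
by move=> u v eq_uv; apply: stern_brocot_pair_inj; rewrite !stern_brocot_pair_Pal eq_uv.
Qed.

(** Numerator plus denominator is two more than the length of the central word
    at the same place, since both parts count one letter with an excess of 1. *)
Lemma stern_brocot_labelP u v l :
  stern_brocot_label (SternBrocot u) l (SternBrocot v) <->
  l = (Posz (size (Pal v)) - Posz (size (Pal u)))%R.
Proof.
have sizeE w : (numq (SternBrocot w) + denq (SternBrocot w))%R =
    Posz (size (Pal w)).+2.
  have [-> ->] := SternBrocot_reduced w; rewrite stern_brocot_pair_Pal /=.
  have -> : size (Pal w) = count_mem lb (Pal w) + count_mem la (Pal w).
    by elim: (Pal w) => [|[] s IH] //=; rewrite IH ?addnS.
  by rewrite -PoszD addSn addnS.
rewrite /stern_brocot_label -addrA -opprD !sizeE.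
by split=> ->; lia.
Qed.

Lemma slope_Pal v x :
  slope (Pal v ++ [:: x; ~~ x]) = SternBrocot v.
Proof.
rewrite SternBrocotE stern_brocot_pair_Pal /slope !count_cat.
by case: x; rewrite /= !(addn0, add0n, addn1).
Qed.

(** * Graphs whose vertices are the positions on a path *)

Lemma isomorphic_by_position (V : eqType) (V' L : Type) (G : lgraph V L)
    (G' : lgraph V' L) (n : nat) (g : nat -> V) (g' : nat -> V') :
  (forall x, vertex G x <-> exists2 k, k <= n & x = g k) ->
  (forall y, vertex G' y <-> exists2 k, k <= n & y = g' k) ->
  (forall j k, j <= n -> k <= n -> g j = g k -> j = k) ->
  (forall j k, j <= n -> k <= n -> g' j = g' k -> j = k) ->
  (forall j l k, j <= n -> k <= n ->
     (edge G (g j) l (g k) <-> edge G' (g' j) l (g' k))) ->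
  isomorphic G G'.
Proof.
move=> vG vG' g_inj g'_inj edgeE.
pose f x := g' (find (fun k => g k == x) (iota 0 n.+1)).
have fE k : k <= n -> f (g k) = g' k.
  move=> le_k; congr g'; set s := iota 0 n.+1.
  have has_k : has (fun i => g i == g k) s.
    by apply/hasP; exists k; rewrite ?mem_iota.
  have lt_f := has_k; rewrite has_find size_iota ltnS in lt_f.
  apply: g_inj => //; have /eqP := nth_find 0 has_k.
  by rewrite /s nth_iota ?add0n.
exists f; split.
- by move=> _ /vG[k le_k ->]; apply/vG'; exists k; rewrite ?fE.
- move=> _ _ /vG[j le_j ->] /vG[k le_k ->]; rewrite !fE // => eq_f.
  by rewrite (g'_inj j k).
- by move=> _ /vG'[k le_k ->]; exists (g k); [apply/vG; exists k | exact: fE].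
- by move=> _ l _ /vG[j le_j ->] /vG[k le_k ->]; rewrite !fE //; exact: edgeE.
Qed.

Lemma path_graph_vertex (T L : Type) (node : word -> T)
    (lab : T -> L -> T -> Prop) (v : word) (s : T) :
  vertex (path_graph node lab v) s <->
  exists2 k, k <= size v & s = node (take k v).
Proof.
split=> [[u pr_u ->]|[k _ ->]]; last by exists (take k v); rewrite ?prefix_take.
by exists (size u); rewrite ?size_prefix //; move: pr_u; rewrite prefixE => /eqP->.
Qed.

Lemma path_edgeP (T L : Type) (node : word -> T) (lab : T -> L -> T -> Prop)
    (v : word) (s : T) (l : L) (k : nat) :
  injective node -> k <= size v ->
  path_edge node lab v s l (node (take k v)) <->
  [/\ 0 < k, s = node (take k.-1 v) & lab s l (node (take k v))].
Proof.
move=> node_inj le_k; split=> [[u [x [pr_u -> /node_inj eq_u lab_l]]]|].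
  have kE : k = (size u).+1 by rewrite -(size_rcons u x) -eq_u size_takel.
  rewrite kE in eq_u lab_l *; split=> //=; congr node.
  by move: eq_u; rewrite (take_nth la) -?kE // => /rcons_inj[].
case: k le_k => [|k] lt_k [//= _ -> lab_l].
exists (take k v), (nth la v k); rewrite -take_nth //.
by split=> //; exact: prefix_take.
Qed.

(** Whether it belongs to the path or jumps to a turn, an edge that ends at
    position [k] carries the label of the path edge that ends there, so the two
    kinds differ only in where they start. *)
Lemma path_graph_edge (T L : Type) (node : word -> T)
    (lab : T -> L -> T -> Prop) (v : word) (j : nat) (l : L) (k : nat) :
  injective node -> j <= size v -> k <= size v ->
  edge (path_graph node lab v) (node (take j v)) l (node (take k v)) <->
  (k = j.+1 \/ after_first_turn v (take j v) (take k v)) /\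
  lab (node (take k.-1 v)) l (node (take k v)).
Proof.
move=> node_inj le_j le_k; split=> /=.
  case=> [/(path_edgeP _ _ _ node_inj le_k)[k0 /node_inj eq_j lab_l]|].
    have jE : j = k.-1.
      by move: (congr1 size eq_j); rewrite !size_takel //; lia.
    by rewrite jE prednK // in lab_l *; split; [left|].
  case=> [[u [w [turn /node_inj eq_j /node_inj eq_k]]]].
  case=> [r /(path_edgeP _ _ _ node_inj le_k)[_ -> lab_l]].
  by rewrite -eq_j -eq_k in turn; split; [right|].
case=> [[kE|turn] lab_l].
  by left; rewrite kE in lab_l le_k *; apply/path_edgeP.
right; split; first by exists (take j v), (take k v).
exists (node (take k.-1 v)); apply/path_edgeP => //; split=> //.
case: turn => x [t [_ /andP[t2 t_x] _ _ /(congr1 size)]].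
by rewrite size_cat !size_takel //; lia.
Qed.

(** * The blocks of the formal word *)

Definition blocks (m : nat) (a : nat -> nat) (n : nat) : seq nat :=
  flatten [seq nseq (cexp m a i.+1) i | i <- iota 0 n].

Lemma blocksS m a n :
  blocks m a n.+1 = blocks m a n ++ nseq (cexp m a n.+1) n.
Proof.
by rewrite /blocks -[n.+1]addn1 iotaD map_cat flatten_cat /= cats0 addn1.
Qed.

Lemma cexp_bexp m a i : cexp m a i = bexp a i - (i == m).
Proof. by rewrite /cexp /bexp; case: eqP => //; rewrite subn0. Qed.

Lemma rev_flatten_nseq (T : Type) n (s : seq T) :
  rev (flatten (nseq n s)) = flatten (nseq n (rev s)).
Proof.
elim: n => //= n IH; rewrite rev_cat IH.
by elim: n {IH} => [|n IH] /=; rewrite ?cats0 // -catA IH.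
Qed.

Lemma LwordS a n :
  Lword a n.+1 =
  rev (Mshift a n) ++ flatten (nseq (bexp a n.+1) (Lword a n)).
Proof. by rewrite /Lword /Mword /= rev_cat rev_flatten_nseq. Qed.

(** Passing the block of [L_n] appends its powers to the label in the other
    direction, which turns [L_(n-1)] into [L_(n+1)]. Written with [Mshift], the
    formula covers [n = 0], where [L_(-1) = b]. *)
Lemma next_label_blocks m a n : n < m ->
  next_label (map odd (blocks m a n)) (odd n) = Lword a n /\
  next_label (map odd (blocks m a n)) (~~ odd n) = rev (Mshift a n).
Proof.
elim: n => [|n IH] lt_n //; have [same other] := IH (ltnW lt_n).
have := next_label_nseq (map odd (blocks m a n)) (odd n) (cexp m a n.+1).
rewrite blocksS map_cat map_nseq same other /= negbK => -[-> ->].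
by rewrite LwordS cexp_bexp (ltn_eqF lt_n) subn0.
Qed.

Lemma next_label_formal_prefix m a n U i : n <= m ->
  prefix (rcons U i) (blocks m a n) -> next_label (map odd U) (odd i) = Lword a i.
Proof.
elim: n => [|n IH] lt_n; first by case: U.
rewrite blocksS; have [le_size|lt_size] := leqP (size (rcons U i)) (size (blocks m a n)).
  by move=> pr; apply: IH; [exact: ltnW|exact: prefix_leq pr (prefix_prefix _ _) _].
rewrite size_rcons ltnS in lt_size.
move/prefixP=> [s eq_s].
have UE : U = blocks m a n ++ drop (size (blocks m a n)) U.
  rewrite -{1}[U](cat_take_drop (size (blocks m a n))); congr (_ ++ _).
  move: (congr1 (take (size (blocks m a n))) eq_s).
  by rewrite (take_size_cat _ (erefl _)) cat_rcons takel_cat.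
move: (drop _ U) UE eq_s => U' ->; rewrite rcons_cat -catA => /eqP.
rewrite eqseq_cat // eqxx /= => /eqP eq_nseq.
have : all (pred1 n) (rcons U' i).
  have := all_pred1_nseq n (cexp m a n.+1).
  by rewrite eq_nseq all_cat => /andP[].
rewrite all_rcons => /andP[/eqP-> /all_pred1P->].
rewrite map_cat map_nseq.
have [same _] := next_label_blocks a lt_n.
by have [-> _] := next_label_nseq (map odd (blocks m a n)) (odd n) (size U').
Qed.

(** Before the last copy of [L_(m-1)] the two labels multiply to [L_m], because
    [c_m = b_m - 1]; so [L_m] is the palindrome preceded by two letters. *)
Lemma Mword_Pal m a : 0 < m -> 0 < bexp a m ->
  Mword a m = Pal (map odd (formal_word m a)) ++ [:: ~~ odd m; odd m].
Proof.
case: m => // n _ b_gt0; apply: (can_inj (@revK _)).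
rewrite rev_cat Pal_palindrome -[rev _]/(Lword a n.+1) LwordS /=.
have [same other] := next_label_blocks a (ltnSn n).
have := next_label_nseq (map odd (blocks n.+1 a n)) (odd n) (cexp n.+1 a n.+1).
rewrite -map_nseq -map_cat -blocksS same other => -[same' other'].
have := next_label_cat (map odd (formal_word n.+1 a)) (~~ odd n).
rewrite negbK other' same' -catA => <-; congr (_ ++ _).
rewrite cexp_bexp eqxx -[bexp a _ in LHS](subnK b_gt0) nseqD flatten_cat /=.
by rewrite cats0.
Qed.

(** Two positions of equal parity linked by [no_skip] carry the same index, and
    two of different parity carry consecutive ones: this is how the letters of
    the path determine the blocks. *)
Definition no_skip (i j : nat) : bool := (j == i) || (j == i.+1).

Lemma no_skip_nseq s n c :
  sorted no_skip s -> last n.-1 s = n.-1 -> sorted no_skip (s ++ nseq c n).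
Proof.
have path_nseq i : no_skip i n -> path no_skip i (nseq c n).
  elim: c i => //= c IH i -> /=; apply: IH; by rewrite /no_skip eqxx.
case: s => [|x s] /= sorted_s lastE.
  by case: c path_nseq => //= c /(_ n); rewrite /no_skip eqxx /= => ->.
rewrite cat_path sorted_s lastE path_nseq // /no_skip.
by case: n {path_nseq lastE} => //= n; rewrite eqxx orbT.
Qed.

Lemma blocks_no_skip m a n : (forall i, 1 <= i <= m -> 0 < a i) -> n <= m ->
  sorted no_skip (blocks m a n) /\
  (n < m -> last n.-1 (blocks m a n) = n.-1).
Proof.
move=> a_gt0; elim: n => [|n IH] lt_n //; have [sorted_n lastE] := IH (ltnW lt_n).
rewrite blocksS; split=> [|lt_n1]; first exact: no_skip_nseq (lastE lt_n).
rewrite last_cat; case: n lt_n1 {IH lt_n} sorted_n lastE => [|n] lt_n _ lastE.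
  by elim: (cexp _ _ _).
suff : 0 < cexp m a n.+2 by case: (cexp _ _ _) => //= c _; elim: c.
by rewrite cexp_bexp (ltn_eqF lt_n) /bexp /= subn0; apply: a_gt0; lia.
Qed.

Lemma blocks_lt m a n : all (fun i => i < n) (blocks m a n).
Proof.
apply/allP=> i /flattenP[_ /mapP[j + ->] /nseqP[-> _]].
by rewrite mem_iota.
Qed.

Lemma parity_break d s t : path no_skip d s -> t < size s ->
  (forall r, r < t -> nth la (map odd s) r = odd d) ->
  nth la (map odd s) t != odd d ->
  take t.+1 s = rcons (nseq t d) d.+1.
Proof.
elim: t s => [|t IH] [|y s] //= /andP[/orP[]/eqP-> path_s] lt_t same differ.
- by rewrite eqxx in differ.
- by rewrite take0.
- by rewrite IH // => r lt_r; exact: (same r.+1).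
- by have := same 0 isT => /=; case: (odd d).
Qed.

(** Along a path without skips, a turn happens exactly between two blocks. *)
Lemma first_turn_block F j k : sorted no_skip F -> j <= size F -> k <= size F ->
  after_first_turn (map odd F) (take j (map odd F)) (take k (map odd F)) <->
  exists i t, 1 <= t /\ take k F = take j F ++ nseq t i ++ [:: i.+1].
Proof.
move=> sortedF le_j le_k; split.
  case=> x [t [Fx /andP[t2 t_x] differ same kE]].
  have xE : x = map odd (drop j F).
    by rewrite map_drop Fx drop_size_cat // size_takel ?size_map.
  have {kE} -> : k = j + t.
    by have := congr1 size kE; rewrite size_cat !size_takel ?size_map.
  rewrite xE in t_x differ same; rewrite size_map in t_x.
  have := drop_sorted j sortedF; rewrite takeD.
  case: (drop j F) t_x differ same => [|d D]; first by case: t t2.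
  case: t t2 => [|[|t]] // _ lt_t differ same pathD; exists d, t.+1; split=> //.
  congr (_ ++ _); rewrite -[take _ _]/(d :: take t.+1 D) (parity_break pathD) ?cats1 //.
  by move=> r lt_r; exact: (same r.+2).
case=> i [t [t1 kE]].
have dropE : drop j F = nseq t i ++ i.+1 :: drop k F.
  by rewrite -{1}[F](cat_take_drop k) kE -!catA drop_size_cat // size_takel.
exists (map odd (drop j F)), t.+1.
have -> : take t.+1 (map odd (drop j F)) = map odd (nseq t i ++ [:: i.+1]).
  rewrite dropE -cat_rcons -cats1 map_cat take_size_cat // size_map.
  by rewrite size_cat size_nseq addn1.
rewrite -!map_take kE; split.
- by rewrite -map_cat cat_take_drop.
- by rewrite dropE size_map size_cat size_nseq /= ltnS t1 /=; lia.
- rewrite dropE map_cat map_nseq !nth_cat size_nseq ltnn t1 subnn nth_nseq t1 /=.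
  by rewrite negb_eqF.
- case=> [|r] //= /andP[r1 lt_r].
  rewrite dropE map_cat map_nseq !nth_cat size_nseq t1 !nth_nseq t1.
  by have -> : r < t by lia.
- by rewrite map_cat.
Qed.

(** * The compact graph *)

Lemma formal_word_vertex m a U :
  prefix U (formal_word m a) <->
  exists2 k, k <= size (formal_word m a) & U = take k (formal_word m a).
Proof.
split=> [pr_U|[k _ ->]]; last exact: prefix_take.
by exists (size U); rewrite ?size_prefix //; move: pr_U; rewrite prefixE => /eqP->.
Qed.

Lemma Pal_formal_prefix m a k : 0 < k <= size (formal_word m a) ->
  Pal (take k (map odd (formal_word m a))) =
  Pal (take k.-1 (map odd (formal_word m a))) ++
    Lword a (last 0 (take k (formal_word m a))).
Proof.
case: k => //= k lt_k; rewrite -!map_take (take_nth 0 lt_k) last_rcons map_rcons.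
rewrite Pal_rcons_label (@next_label_formal_prefix m a m) //.
by rewrite -take_nth // prefix_take.
Qed.

Lemma compact_graph_edge m a j l k (F := formal_word m a) (v := map odd F) :
  (forall i, 1 <= i <= m -> 0 < a i) -> j <= size F -> k <= size F ->
  edge (compact_graph m a) (take j F) l (take k F) <->
  (k = j.+1 \/ after_first_turn v (take j v) (take k v)) /\
  l = Lword a (last 0 (take k F)).
Proof.
move=> a_gt0 le_j le_k.
have [sortedF _] := blocks_no_skip a_gt0 (leqnn m).
have turnE := first_turn_block sortedF le_j le_k.
have lt_last : 0 < k -> last 0 (take k F) < m.
  case: k le_k {turnE} => // k lt_k _; rewrite (take_nth 0 lt_k) last_rcons.
  exact: (allP (blocks_lt m a m)) (mem_nth 0 lt_k).
split=> /=.
  case=> _ [[i [_ kE ->]]|[i [t [_ t1 kE ->]]]]; split.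
  - by left; have := congr1 size kE; rewrite size_cat !size_takel // addn1.
  - by rewrite kE last_cat.
  - by right; apply/turnE; exists i, t.
  - by rewrite kE !last_cat.
case=> turn ->; split; first exact: prefix_take.
case: turn => [kE|/turnE[i [t [t1 kE]]]].
  left; exists (last 0 (take k F)); rewrite lt_last ?kE //; split=> //.
  by rewrite (take_nth 0) -?kE // last_rcons cats1.
right; exists i, t; rewrite kE !last_cat /=; split=> //.
have k0 : 0 < k.
  by have := congr1 size kE; rewrite !size_cat !size_takel //=; lia.
by have := lt_last k0; rewrite kE !last_cat /=; lia.
Qed.

(** Both graphs live on the positions [0, ..., |v|] of the path: the vertex at
    position [k] is the node coded by the prefix of length [k] of [v] on one
    side, and the formal prefix of length [k] on the other. The map [f] turns
    word labels into those of [G]: the identity gives the compact graph, the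
    length gives the Sturmian graph. *)
Lemma path_graph_isomorphic m a (T : eqType) (L : Type) (node : word -> T)
    (lab : T -> L -> T -> Prop) (f : word -> L) (G : lgraph (seq nat) L)
    (F := formal_word m a) (v := map odd F) :
  (forall i, 1 <= i <= m -> 0 < a i) -> injective node ->
  (forall k l, 0 < k <= size F ->
     (lab (node (take k.-1 v)) l (node (take k v)) <->
      l = f (Lword a (last 0 (take k F))))) ->
  (forall U, vertex G U <-> vertex (compact_graph m a) U) ->
  (forall U l V, edge G U l V <->
     exists2 w, edge (compact_graph m a) U w V & l = f w) ->
  isomorphic (path_graph node lab v) G.
Proof.
move=> a_gt0 node_inj labE vertexG edgeG.
have szv : size v = size F by rewrite size_map.
apply: (isomorphic_by_position (n := size F) (g := fun k => node (take k v))
  (g' := fun k => take k F)).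
- by move=> s; rewrite -szv; exact: path_graph_vertex.
- by move=> U; apply: iff_trans (vertexG U) _; exact: formal_word_vertex.
- move=> j k le_j le_k /node_inj/(congr1 size).
  by rewrite !size_takel ?szv.
- by move=> j k le_j le_k /(congr1 size); rewrite !size_takel.
move=> j l k le_j le_k; apply: iff_trans (iff_sym (edgeG _ _ _)).
apply: (iff_trans (path_graph_edge _ _ node_inj _ _)); rewrite ?szv //.
have k_gt0 : k = j.+1 \/ after_first_turn v (take j v) (take k v) -> 0 < k.
  case=> [->|[x [t [_ /andP[t2 t_x] _ _ /(congr1 size)]]]] //.
  by rewrite size_cat !size_takel ?szv //; lia.
split=> [[turn]|[w]].
  rewrite labE ?k_gt0 // => ->.
  by eexists; first by apply/compact_graph_edge.
move/(compact_graph_edge _ a_gt0 le_j le_k) => [turn ->] ->.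
by split=> //; apply/labE; rewrite ?k_gt0.
Qed.

Theorem corollary9p5 (m : nat) (a : nat -> nat) (p : word)
    (m_gt0 : 0 < m)
    (a_gt0 : forall i : nat, 1 <= i <= m -> 0 < a i)
    (M_eq : Mword a m = p ++ (if odd m then [:: la; lb] else [:: lb; la])) :
  (exists v : word,
     unique (fun u : word => Pal u = p) v /\
     isomorphic (central_path_graph v) (compact_graph m a)) /\
  (exists v : word,
     unique (fun u : word => SternBrocot u = slope (Mword a m)) v /\
     isomorphic (stern_brocot_path_graph v) (sturmian_graph m a)).
Proof.
(* Only [m = a_1 = 1] makes [b_m] vanish, and then [M_1 = b] is too short. *)
have b_gt0 : 0 < bexp a m.
  rewrite /bexp; case: eqP => m1; last by rewrite a_gt0 // m_gt0 /=.
  move: M_eq; rewrite m1 /Mword /= /bexp /=; case: (a 1 - 1) => //= eq_b.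
  by have := congr1 size eq_b; rewrite size_cat addn2.
have M_Pal := Mword_Pal m_gt0 b_gt0.
set v := map odd (formal_word m a) in M_Pal.
have endE : [:: ~~ odd m; odd m] = if odd m then [:: la; lb] else [:: lb; la].
  by case: (odd m).
have pE : Pal v = p.
  have : rcons (rcons (Pal v) (~~ odd m)) (odd m) =
         rcons (rcons p (~~ odd m)) (odd m).
    by rewrite -!cats1 -!catA /= -M_Pal endE.
  by case/rcons_inj => /rcons_inj[].
split; exists v; split.
- by split=> // u; rewrite -pE => /Pal_inj.
- apply: (path_graph_isomorphic (f := id)) => //; first exact: Pal_inj.
    move=> k l lt_k; rewrite /central_label (Pal_formal_prefix lt_k).
    by split=> [/eqP|->] //; rewrite eqseq_cat // eqxx => /eqP->.
  by move=> U l V; split=> [e|[w e ->]] //; exists l.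
- have slopeE : slope (Mword a m) = SternBrocot v.
    by rewrite M_Pal -{2}[odd m]negbK slope_Pal.
  by split=> // u; rewrite slopeE => /SternBrocot_inj.
- apply: (path_graph_isomorphic (f := fun w : word => Posz (size w))) => //.
    exact: SternBrocot_inj.
  move=> k l lt_k; apply: (iff_trans (stern_brocot_labelP _ _ _)).
  by rewrite (Pal_formal_prefix lt_k) size_cat PoszD addrC addKr.
Qed.
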